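(* Let $A$ be a finite alphabet with $|A|\ge 2$. Let $N$ be a multiple unicast network coding instance in circuit representation, with $r$ sources, $r$ destinations and $m$ intermediate nodes, and let $D$ be the digraph on $n=r+m$ vertices obtained from $N$ by merging each source with its corresponding destination. Then $N$ is solvable over $A$ if and only if the closure operator $\mathrm{cl}_D$ has rank $r$ and is solvable over $A$.
   Context: Network: $N$ is a finite acyclic digraph with sources $s_1,\dots,s_r$ (no incoming arcs), destinations $d_1,\dots,d_r$ (no outgoing arcs) and $m$ intermediate nodes. Source $s_i$ holds a message $x_i\in A$, and destination $d_i$ requests $x_i$. Each vertex transmits one element of $A$, the same on all its outgoing arcs (circuit representation): $s_i$ transmits $x_i$, and each intermediate node transmits an element of $A$ given by a function of the elements it receives on its incoming arcs. $N$ is solvable over $A$ if the functions at the intermediate nodes, together with decoding functions at the destinations (each depending only on the elements received by that destination), can be chosen so that for all $(x_1,\dots,x_r)\in A^r$ every $d_i$ recovers $x_i$. The digraph $D$: $s_i$ and $d_i$ are merged into a single vertex $i$ ($1\le i\le r$), whose in-neighbours are those of $d_i$ and whose out-neighbours are those of $s_i$ (under the merging; an arc from $s_i$ to $d_i$ becomes a loop on $i$); the intermediate nodes are kept, as vertices $r+1,\dots,n$. $D$-closure: let $V$ be the vertex set of $D$, $|V|=n$, and let $v^-$ be the in-neighbourhood of $v$. For $X\subseteq V$ let $c_D(X)=X\cup\{v\in V: v^-\subseteq X\}$ and $\mathrm{cl}_D(X)=c_D^n(X)$ ($n$-fold iteration); this is a closure operator on $V$. Rank: the rank of a closure operator $\mathrm{cl}$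 on $V$ is $\min\{|b|: b\subseteq V,\ \mathrm{cl}(b)=V\}$. Closure solvability: let $\mathrm{cl}$ be a closure operator of rank $r$ on $V$. For a family $f=(f_v)_{v\in V}$ of partitions of $A^r$ and $X\subseteq V$, $f_X$ denotes the common refinement of the $f_v$, $v\in X$ (parts are the nonempty intersections of parts; $f_\emptyset$ is the one-part partition). A coding function for $\mathrm{cl}$ over $A$ is a family $f=(f_v)_{v\in V}$ of partitions of $A^r$, each into at most $|A|$ parts, such that $f_X=f_{\mathrm{cl}(X)}$ for all $X\subseteq V$. $\mathrm{cl}$ is solvable over $A$ if it has a coding function $f$ such that $f_V$ is the partition of $A^r$ into singletons. *)

(* Defs.v *)
From HB Require Import structures.
From mathcomp Require Import all_boot.

Set Implicit Arguments.
Unset Strict Implicit.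
Unset Printing Implicit Defensive.

(** * Closure operators *)

Record closure_op (V : finType) := ClosureOp {
  cl_fun :> {set V} -> {set V};
  cl_ext : forall X : {set V}, X \subset cl_fun X;
  cl_mono : forall X Y : {set V}, X \subset Y -> cl_fun X \subset cl_fun Y;
  cl_idem : forall X : {set V}, cl_fun (cl_fun X) = cl_fun X
}.

(* The minimum ranges over a nonempty set: cl V = V by extensivity. *)
Definition cl_rank (V : finType) (cl : closure_op V) : nat :=
  #|[arg min_(b < [set: V] | cl b == [set: V]) #|b| ]|.

(** * The closure operator of a digraph (loops allowed) *)

Section DigraphClosure.
Variables (V : finType) (arc : rel V).

Definition in_nbh (v : V) : {set V} := [set u | arc u v].

Definition c_step (X : {set V}) : {set V} :=
  X :|: [set v | in_nbh v \subset X].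

Definition cl_digraph_fun (X : {set V}) : {set V} := iter #|V| c_step X.

Lemma c_step_ext (X : {set V}) : X \subset c_step X.
Proof. exact: subsetUl. Qed.

Lemma c_step_mono (X Y : {set V}) : X \subset Y -> c_step X \subset c_step Y.
Proof.
move=> sXY; apply: setUSS => //; apply/subsetP => v; rewrite !inE => sv.
exact: subset_trans sv sXY.
Qed.

Lemma iter_c_step_ext n (X : {set V}) : X \subset iter n c_step X.
Proof.
by elim: n => //= n IHn; apply: subset_trans IHn (c_step_ext _).
Qed.

Lemma iter_c_step_mono n (X Y : {set V}) :
  X \subset Y -> iter n c_step X \subset iter n c_step Y.
Proof. by move=> sXY; elim: n => //= n; apply: c_step_mono. Qed.

Lemma c_step_cl_digraph (X : {set V}) : c_step (cl_digraph_fun X) = cl_digraph_fun X.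
Proof.
have fix_or_grow k :
    c_step (iter k c_step X) = iter k c_step X \/ k <= #|iter k c_step X|.
  elim: k => [|k [fixk | lek]] /=; first by right.
    by left; rewrite !fixk.
  set Y := iter k c_step X in lek *.
  have [fixY | neY] := eqVneq (c_step Y) Y; first by left; rewrite !fixY.
  right; apply: leq_ltn_trans lek (proper_card _).
  by rewrite properEneq eq_sym neY c_step_ext.
case: (fix_or_grow #|V|) => // leV.
suff ->: cl_digraph_fun X = [set: V] by apply: setTU.
by apply/eqP; rewrite eqEcard subsetT cardsT.
Qed.

Lemma cl_digraph_idem (X : {set V}) :
  cl_digraph_fun (cl_digraph_fun X) = cl_digraph_fun X.
Proof.
rewrite {1}/cl_digraph_fun; elim: #|V| => //= n ->; exact: c_step_cl_digraph.
Qed.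

Definition cl_digraph : closure_op V :=
  ClosureOp (iter_c_step_ext #|V|) (@iter_c_step_mono #|V|) cl_digraph_idem.

End DigraphClosure.

(** * Coding functions and closure solvability *)

(* The common refinement f_X of the f_v, v in X: here g chooses a part of
   each f_v with v in X; for X empty the only intersection is [set: T]. *)
Definition refinement (V T : finType) (f : V -> {set {set T}}) (X : {set V}) :
    {set {set T}} :=
  [set \bigcap_(v in X) g v
     | g : {ffun V -> {set T}} & [forall v in X, g v \in f v]] :\ set0.

Definition coding_function (V : finType) (cl : closure_op V) (A : finType)
    (f : V -> {set {set {ffun 'I_(cl_rank cl) -> A}}}) : Prop :=
  [/\ forall v, partition (f v) [set: {ffun 'I_(cl_rank cl) -> A}],
      forall v, #|f v| <= #|A|
    & forall X : {set V}, refinement f X = refinement f (cl X)].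

Definition closure_solvable (V : finType) (cl : closure_op V) (A : finType) :
    Prop :=
  exists f : V -> {set {set {ffun 'I_(cl_rank cl) -> A}}},
    coding_function f /\
    refinement f [set: V] = [set [set x] | x : {ffun 'I_(cl_rank cl) -> A}].

(** * Multiple unicast networks in circuit representation *)

(* Sources, destinations and intermediate nodes. *)
Definition node (r m : nat) : Type := ('I_r + 'I_r + 'I_m)%type.

HB.instance Definition _ r m := Finite.on (node r m).

Definition src {r m : nat} (i : 'I_r) : node r m := inl (inl i).
Definition dst {r m : nat} (i : 'I_r) : node r m := inl (inr i).
Definition mid {r m : nat} (u : 'I_m) : node r m := inr u.

Record network (r m : nat) := Network {
  arc :> rel (node r m);
  arc_acyclic : forall v p, ~~ cycle arc (v :: p);
  arc_to_src : forall v i, ~~ arc v (src i);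
  arc_from_dst : forall v i, ~~ arc (dst i) v
}.

Section NetworkSolvability.
Variables (r m : nat) (N : network r m) (A : finType).

Definition inputs (v : node r m) : Type := {ffun {w | N w v} -> A}.

Definition received (t : node r m -> A) (v : node r m) : inputs v :=
  [ffun w : {w | N w v} => t (val w)].

(* t is the assignment of transmitted elements when the messages are x and the
   intermediate node u applies phi u. By acyclicity, x and phi determine t on
   sources and intermediate nodes; the value of t at a destination is
   irrelevant, since destinations have no outgoing arcs. *)
Definition transmission (phi : forall u : 'I_m, inputs (mid u) -> A)
    (x : {ffun 'I_r -> A}) (t : node r m -> A) : Prop :=
  (forall i, t (src i) = x i) /\
  (forall u, t (mid u) = phi u (received t (mid u))).

Definition network_solvable : Prop :=
  exists (phi : forall u : 'I_m, inputs (mid u) -> A)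
         (psi : forall i : 'I_r, inputs (dst i) -> A),
    forall x : {ffun 'I_r -> A},
      exists2 t : node r m -> A, transmission phi x t
        & forall i, psi i (received t (dst i)) = x i.

End NetworkSolvability.

(** * Merging each source with its destination *)

(* The vertex lshift m i of the merged digraph stands for both src i (as the
   tail of an arc) and dst i (as the head); rshift r u stands for mid u. *)
Definition as_tail {r m : nat} (v : 'I_(r + m)) : node r m :=
  match split v with inl i => src i | inr u => mid u end.

Definition as_head {r m : nat} (v : 'I_(r + m)) : node r m :=
  match split v with inl i => dst i | inr u => mid u end.

Definition merged (r m : nat) (N : network r m) : rel 'I_(r + m) :=
  fun v w => N (as_tail v) (as_head w).

(* Main.v *)
(** Label the parts of the partitions f_v by letters, so that a coding function
becomes a family of maps F_v : T -> A such that x and y which agree on X agree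
on cl X.  For cl_D it is enough to ask this at in-neighbourhoods: F_v factors
through the inputs of v, at a source-destination vertex by decoding and at an
intermediate node by coding.  Acyclicity makes the r merged vertices span, so
the rank is at most r; since 2 <= |A|, a faithful family on A^r cannot be
determined by fewer than r of its members.  Conversely, the maps F_1, ..., F_r
of a solution together form an injective, hence bijective, map A^r -> A^r, and
precomposing with its inverse turns F_i into the i-th message. *)

Require Import Defs.
From mathcomp Require Import all_boot.

Set Implicit Arguments.
Unset Strict Implicit.
Unset Printing Implicit Defensive.

(** * Induction along an acyclic relation, and factoring of maps *)

(** Induction on the number of ancestors of [v]: an arc from [w] to [v] makes the ancestors of [w] a
    proper subset, since [v] reaching [w] would close a cycle. *)
Lemma acyclic_ind (T : finType) (e : rel T) (P : T -> Prop) :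
  (forall v p, ~~ cycle e (v :: p)) ->
  (forall v, (forall w, e w v -> P w) -> P v) -> forall v, P v.
Proof.
move=> acyc IH v; have [n] := ubnP #|[set w | connect e w v]|.
elim: n v => // n IHn v /ltnSE lev; apply: IH => w ewv.
apply: IHn; apply: leq_trans lev; apply/proper_card/properP; split.
  apply/subsetP => z; rewrite !inE => /connect_trans; apply; exact: connect1.
exists v; rewrite inE ?connect0 //; apply/negP => /connectP[p pth def_w].
by move/negP: (acyc v p); apply; rewrite /= rcons_path pth -def_w.
Qed.

Lemma fun_factor (T : finType) (U : eqType) (A : Type) (a : A)
    (g : T -> U) (h : T -> A) :
  (forall x y, g x = g y -> h x = h y) -> exists k, forall x, k (g x) = h x.
Proof.
move=> gh; exists (fun u => if [pick x | g x == u] is Some x then h x else a).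
by move=> x; case: pickP => [y /eqP/gh // | /(_ x)]; rewrite eqxx.
Qed.

(** * Rank of a closure operator *)

Section Rank.
Variables (V : finType) (cl : closure_op V).

Lemma cl_rank_le (b : {set V}) : cl b = [set: V] -> cl_rank cl <= #|b|.
Proof.
rewrite /cl_rank; case: arg_minnP => [|c _ min_c clb]; last exact/min_c/eqP.
by rewrite eqEsubset subsetT cl_ext.
Qed.

Lemma cl_rank_witness : exists2 b : {set V}, cl b = [set: V] & #|b| = cl_rank cl.
Proof.
rewrite /cl_rank; case: arg_minnP => [|c /eqP clc _]; last by exists c.
by rewrite eqEsubset subsetT cl_ext.
Qed.

End Rank.

(** * Common refinements as equivalence relations on points *)

Section Refinement.
Variables (V T : finType) (f : V -> {set {set T}}).
Hypothesis f_part : forall v, partition (f v) [set: T].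

(** The part of the common refinement over [X] that contains [x]. *)
Let cls (X : {set V}) x := \bigcap_(v in X) pblock (f v) x.

Let in_cover v x : x \in cover (f v).
Proof. by rewrite (cover_partition (f_part v)) inE. Qed.

Let f_triv v : trivIset (f v).
Proof. exact: partition_trivIset (f_part v). Qed.

Let in_cls (X : {set V}) x y :
  reflect {in X, forall v, pblock (f v) x = pblock (f v) y} (y \in cls X x).
Proof.
apply: (iffP bigcapP) => xy v /xy; first by move/(same_pblock (f_triv v)).
by move->; rewrite mem_pblock.
Qed.

Let cls_eq X x y : y \in cls X x -> cls X x = cls X y.
Proof. by move/in_cls=> xy; apply: eq_bigr => v /xy. Qed.

Let mem_cls X x : x \in cls X x.
Proof. exact/in_cls. Qed.

Let refinement_cls X : refinement f X = [set cls X x | x : T].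
Proof.
apply/setP=> B; rewrite !inE; apply/andP/imsetP => [[/set0Pn[x Bx]] | [x _ ->]].
  case/imsetP=> g; rewrite inE => /forall_inP gf defB; exists x => //.
  (* Every chosen part [g v] contains [x], hence is the block of [x]. *)
  rewrite defB in Bx *; apply: eq_bigr => v Xv.
  by rewrite (def_pblock (f_triv v) (gf v Xv)) //; apply: (bigcapP Bx).
split; first by apply/set0Pn; exists x.
apply/imsetP; exists [ffun v => pblock (f v) x].
  by rewrite inE; apply/forall_inP => v _; rewrite ffunE pblock_mem.
by apply: eq_bigr => v _; rewrite ffunE.
Qed.

Lemma refinement_eqP (X Y : {set V}) :
  refinement f X = refinement f Y <->
  forall x y, {in X, forall v, pblock (f v) x = pblock (f v) y} <->
              {in Y, forall v, pblock (f v) x = pblock (f v) y}.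
Proof.
rewrite !refinement_cls; split=> [eqXY x y | eqXY].
  suff eq_cls: cls X x = cls Y x.
    by split=> /in_cls xy; apply/in_cls; rewrite ?eq_cls // -eq_cls.
  have: cls X x \in [set cls Y x | x : T] by rewrite -eqXY imset_f.
  case/imsetP=> z _ defX; rewrite defX; apply: cls_eq; rewrite -defX.
  exact: mem_cls.
apply: eq_imset => x; apply/setP=> y.
by apply/in_cls/in_cls => /eqXY.
Qed.

Lemma refinement_singletonsP :
  refinement f [set: V] = [set [set x] | x : T] <->
  forall x y, (forall v, pblock (f v) x = pblock (f v) y) -> x = y.
Proof.
rewrite refinement_cls; split=> [eqVs x y xy | faith].
  have: cls [set: V] x \in [set [set x] | x : T] by rewrite -eqVs imset_f.
  case/imsetP=> z _ defV.
  have: x \in cls [set: V] x by apply: mem_cls.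
  have: y \in cls [set: V] x by apply/in_cls => v _.
  by rewrite defV !inE => /eqP-> /eqP->.
apply: eq_imset => x; apply/setP=> y; rewrite inE.
apply/in_cls/eqP => [xy | -> //]; apply/esym/faith => v; exact: xy.
Qed.

End Refinement.

(** * Coding functions as families of maps *)

Definition determined_by_cl (V : finType) (cl : closure_op V) (T A : Type)
    (F : V -> T -> A) : Prop :=
  forall (X : {set V}) x y,
    {in X, forall v, F v x = F v y} -> {in cl X, forall v, F v x = F v y}.

Definition faithful (V T A : Type) (F : V -> T -> A) : Prop :=
  forall x y, (forall v, F v x = F v y) -> x = y.

(** A part is labelled by the letter of the same index; [#|P| <= #|A|] keeps every index in range,
    so the default [a] is never returned and distinct parts get distinct letters. *)
Lemma partition_label (T A : finType) (a : A) (P : {set {set T}}) :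
  partition P [set: T] -> #|P| <= #|A| ->
  exists h : T -> A, forall x y, h x = h y <-> pblock P x = pblock P y.
Proof.
move=> partP leP.
have inP x : pblock P x \in enum P.
  by rewrite mem_enum pblock_mem ?(cover_partition partP).
exists (fun x => nth a (enum A) (index (pblock P x) (enum P))) => x y.
split=> [/eqP|-> //]; rewrite nth_uniq ?enum_uniq //; last first.
- by rewrite -cardE (leq_trans _ leP) // [X in _ < X]cardE index_mem.
- by rewrite -cardE (leq_trans _ leP) // [X in _ < X]cardE index_mem.
by move=> /eqP/(index_inj set0 (inP x) (inP y)).
Qed.

Lemma card_preim_partition (T A : finType) (h : T -> A) (D : {set T}) :
  #|preim_partition h D| <= #|A|.
Proof.
rewrite -cardsT; pose fib a := [set y in D | a == h y].
apply: leq_trans (leq_imset_card fib _); apply/subset_leq_card/subsetP.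
by move=> _ /imsetP[x _ ->]; apply/imsetP; exists (h x).
Qed.

Lemma closure_solvableP (V : finType) (cl : closure_op V) (A : finType) (a : A) :
  closure_solvable cl A <->
  exists2 F : V -> {ffun 'I_(cl_rank cl) -> A} -> A,
    determined_by_cl cl F & faithful F.
Proof.
split=> [[f [[f_part f_card f_cl] f_sing]] | [F F_cl F_faith]].
  have [F FP] := fin_all_exists
    (fun v => partition_label a (f_part v) (f_card v)).
  exists F => [X x y xy v Xv | x y xy].
    apply/FP; move: v Xv; apply/(proj1 (refinement_eqP f_part _ _) (f_cl X)).
    by move=> v Xv; apply/FP/xy.
  apply: (proj1 (refinement_singletonsP f_part) f_sing) => v; exact/FP.
pose f v := preim_partition (F v) setT.
have f_part v : partition (f v) setT by apply: preim_partitionP.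
have FP v x y : pblock (f v) x = pblock (f v) y <-> F v x = F v y.
  suff eqFP : (pblock (f v) x == pblock (f v) y) = (F v x == F v y).
    by split=> /eqP; [rewrite eqFP | rewrite -eqFP] => /eqP.
  rewrite eq_pblock ?(partition_trivIset (f_part v)) //; last first.
    by rewrite (cover_partition (f_part v)) inE.
  by rewrite pblock_equivalence_partition ?inE // => ? ? ? *; split=> // /eqP->.
exists f; split; first split=> // [v | X].
- exact: card_preim_partition.
(* Agreement on [cl X] restricts to [X] by extensivity; the other direction is [F_cl]. *)
- apply/refinement_eqP => // x y; split=> xy v Xv; apply/FP; last first.
    by apply/FP/xy/(subsetP (cl_ext cl X)).
  by apply: (F_cl X) => // w Xw; apply/FP/xy.
apply/refinement_singletonsP => // x y xy; apply: F_faith => v; exact/FP.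
Qed.

(** * Digraph closures and the lower bound on the rank *)

Lemma in_cl_digraph (V : finType) (e : rel V) (X : {set V}) v :
  in_nbh e v \subset cl_digraph e X -> v \in cl_digraph e X.
Proof.
move=> sv; have /setP/(_ v) <- := c_step_cl_digraph e X.
by rewrite !inE sv orbT.
Qed.

(** The closure of an in-neighbourhood contains its vertex; conversely, each iteration of [c_step]
    adds only vertices covered by the local condition. *)
Lemma determined_by_cl_digraph (V : finType) (e : rel V) (T A : Type)
    (F : V -> T -> A) :
  determined_by_cl (cl_digraph e) F <->
  forall v x y, (forall w, e w v -> F w x = F w y) -> F v x = F v y.
Proof.
split=> [F_cl v x y xy | F_loc X x y xy].
  apply: (F_cl (in_nbh e v)); first by move=> w; rewrite inE => /xy.
  apply: in_cl_digraph; exact: cl_ext.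
rewrite /= /cl_digraph_fun; elim: #|V| => //= n IHn v.
rewrite !inE => /orP[/IHn // | /subsetP sv].
by apply: F_loc => w ewv; apply/IHn/sv; rewrite inE.
Qed.

(** Restricting the family to a spanning set [b] of minimum size embeds A^r into A^b; as [1 < #|A|],
    the exponents compare. *)
Lemma rank_lower_bound (V : finType) (cl : closure_op V) (A : finType) (r : nat)
    (F : V -> {ffun 'I_r -> A} -> A) :
  1 < #|A| -> determined_by_cl cl F -> faithful F -> r <= cl_rank cl.
Proof.
move=> A_gt1 F_cl F_faith; have [b clb <-] := cl_rank_witness cl.
pose G x : {ffun {v | v \in b} -> A} := [ffun v => F (val v) x].
have injG : injective G.
  move=> x y /ffunP Gxy; apply: F_faith => v.
  apply: (F_cl b) => [w bw|]; last by rewrite clb.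
  by have := Gxy (exist _ w bw); rewrite !ffunE.
have := leq_card G injG.
by rewrite !card_ffun card_ord card_sig leq_exp2l.
Qed.

(** * The merged digraph of a network *)

Section Merge.
Variables r m : nat.

Lemma as_tail_lshift (i : 'I_r) : as_tail (lshift m i) = src i.
Proof. by rewrite /as_tail (unsplitK (inl i)). Qed.

Lemma as_tail_rshift (u : 'I_m) : as_tail (rshift r u) = mid u.
Proof. by rewrite /as_tail (unsplitK (inr u)). Qed.

Lemma as_head_lshift (i : 'I_r) : as_head (lshift m i) = dst i.
Proof. by rewrite /as_head (unsplitK (inl i)). Qed.

Lemma as_head_rshift (u : 'I_m) : as_head (rshift r u) = mid u.
Proof. by rewrite /as_head (unsplitK (inr u)). Qed.

Definition mergeE :=
  (as_tail_lshift, as_tail_rshift, as_head_lshift, as_head_rshift).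

Variable N : network r m.

Lemma tail_of_arc v w : N w v -> exists k : 'I_(r + m), w = as_tail k.
Proof.
case: w => [[i | i] | u] Nwv; first by exists (lshift m i); rewrite mergeE.
  by have := arc_from_dst N v i; rewrite -[dst i]/(inl (inr i)) Nwv.
by exists (rshift r u); rewrite mergeE.
Qed.

Lemma cl_merged_sources :
  cl_digraph (merged N) [set lshift m i | i : 'I_r] = [set: 'I_(r + m)].
Proof.
set b := [set _ | _ : _]; apply/setP=> k; rewrite inE.
(* The merged digraph may have cycles, so the induction runs over the nodes of [N], each vertex
   being represented by its tail. *)
move: {2}(as_tail k) (erefl (as_tail k)) => v; move: v k.
apply: (acyclic_ind (@arc_acyclic _ _ N)) => v IHv k def_v.
case: (split_ordP k) def_v => [i -> _ | u -> def_v].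
  by apply: (subsetP (cl_ext _ b)); apply: imset_f.
apply: in_cl_digraph; apply/subsetP=> w; rewrite inE /merged => Nwu.
by apply: (IHv _ _ w (erefl _)); rewrite -def_v; move: Nwu; rewrite !mergeE.
Qed.

Lemma cl_rank_merged_le : cl_rank (cl_digraph (merged N)) <= r.
Proof.
apply: leq_trans (cl_rank_le cl_merged_sources) _.
by rewrite (leq_trans (leq_imset_card _ _)) // cardT size_enum_ord.
Qed.

Variable A : finType.

Lemma received_eqP v (t t' : node r m -> A) :
  received N t v = received N t' v <-> forall w, N w v -> t w = t' w.
Proof.
split=> [/ffunP tt' w Nwv | tt'].
  by have := tt' (exist _ w Nwv); rewrite !ffunE.
by apply/ffunP=> -[w Nwv]; rewrite !ffunE tt'.
Qed.

Lemma network_solvable_family :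
  network_solvable N A ->
  exists2 F : 'I_(r + m) -> {ffun 'I_r -> A} -> A,
    determined_by_cl (cl_digraph (merged N)) F & faithful F.
Proof.
case=> phi [psi /fin_all_exists2[t tP decP]].
(* [F] at a vertex is what its tail transmits, so at a merged vertex it is the message itself. *)
exists (fun v x => t x (as_tail v)) => [|x y xy].
  apply/determined_by_cl_digraph => v x y xy.
  have eq_in : received N (t x) (as_head v) = received N (t y) (as_head v).
    apply/received_eqP => w Nwv; have [k def_w] := tail_of_arc Nwv.
    by rewrite def_w; apply: xy; rewrite /merged -def_w.
  case: (split_ordP v) eq_in => [i -> | u ->]; rewrite !mergeE => eq_in.
    by rewrite !(proj1 (tP _)) -!decP eq_in.
  by rewrite !(proj2 (tP _)) eq_in.
apply/ffunP=> i; rewrite -!(proj1 (tP _)).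
by have := xy (lshift m i); rewrite mergeE.
Qed.

Lemma family_network_solvable (a : A)
    (F : 'I_(r + m) -> {ffun 'I_r -> A} -> A) :
  determined_by_cl (cl_digraph (merged N)) F -> faithful F ->
  network_solvable N A.
Proof.
move=> F_cl F_faith.
pose msg x : {ffun 'I_r -> A} := [ffun i => F (lshift m i) x].
have inj_msg : injective msg.
  move=> x y /ffunP eq_msg; apply: F_faith => v.
  (* The merged vertices span, so their values determine the whole family. *)
  apply: (F_cl [set lshift m i | i : 'I_r]); last by rewrite cl_merged_sources.
  by move=> _ /imsetP[i _ ->]; have := eq_msg i; rewrite !ffunE.
pose enc := invF inj_msg.
have F_src i x : F (lshift m i) (enc x) = x i.
  by have /ffunP/(_ i) := f_invF inj_msg x; rewrite ffunE.
(* After the change of variables [enc], the sources send the actual messages; the letter [a] at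
   destinations is arbitrary, as it is never received. *)
pose t (x : {ffun 'I_r -> A}) (w : node r m) : A :=
  match w with
  | inl (inl i) => x i
  | inl (inr i) => a
  | inr u => F (rshift r u) (enc x)
  end.
have t_tail k x : t x (as_tail k) = F k (enc x).
  by case: (split_ordP k) => [i -> | u ->]; rewrite mergeE //= F_src.
have t_loc v x y :
    received N (t x) (as_head v) = received N (t y) (as_head v) ->
    t x (as_tail v) = t y (as_tail v).
  move/received_eqP=> xy; rewrite !t_tail.
  apply: (proj1 (determined_by_cl_digraph _ _) F_cl) => w Nwv.
  by rewrite -!t_tail xy.
have phi_ex (u : 'I_m) : exists phi : inputs N A (mid u) -> A,
    forall x, phi (received N (t x) (mid u)) = t x (mid u).
  apply: (fun_factor a) => x y.
  by have := @t_loc (rshift r u) x y; rewrite !mergeE.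
(* At a merged vertex the head is [dst i] and the tail [src i], so [t_loc] says that the inputs of
   [dst i] determine [x i]. *)
have psi_ex (i : 'I_r) : exists psi : inputs N A (dst i) -> A,
    forall x, psi (received N (t x) (dst i)) = x i.
  apply: (fun_factor a) => x y.
  by have := @t_loc (lshift m i) x y; rewrite !mergeE.
have [phi phiP] := fin_all_exists phi_ex.
have [psi psiP] := fin_all_exists psi_ex.
exists phi, psi => x; exists (t x) => [|i]; last exact: psiP.
by split=> // u; rewrite phiP.
Qed.

End Merge.

Theorem theorem1 (A : finType) (hA : 2 <= #|A|) (r m : nat) (N : network r m) :
  network_solvable N A <->
  cl_rank (cl_digraph (merged N)) = r /\
  closure_solvable (cl_digraph (merged N)) A.
Proof.
have [a _] : exists a, a \in A by apply/card_gt0P/ltnW.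
have solvP := closure_solvableP (cl_digraph (merged N)) a.
split=> [/network_solvable_family[F F_cl F_faith] | [rankN /solvP]].
  have rankN : cl_rank (cl_digraph (merged N)) = r.
    apply/eqP; rewrite eqn_leq cl_rank_merged_le.
    exact: rank_lower_bound F_cl F_faith.
  (* The rank equality identifies the domain in [closure_solvable] with the space of messages. *)
  by split=> //; apply/solvP; rewrite rankN; exists F.
by rewrite rankN => -[F]; apply: family_network_solvable.
Qed.
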